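(* Let $k\geq2$ and $n\geq2$. Then the matching preclusion number of the DCell is $mp(D_{k,n})=n+k-1$. Moreover, $D_{k,n}$ is super matched.
   Context: DCell $D_{k,n}$ ($n\geq 2$, $k\geq 0$) is defined recursively. $D_{0,n}$ is the complete graph $K_n$ on vertices $0,1,\dots,n-1$. Let $t_{k,n}=|V(D_{k,n})|$. For $k\geq1$, $D_{k,n}$ is built from $t_{k-1,n}+1$ disjoint copies $D^0_{k-1,n},\dots,D^{t_{k-1,n}}_{k-1,n}$ of $D_{k-1,n}$; a vertex of copy $D^i_{k-1,n}$ is labeled $(i,a_{k-1},\dots,a_0)$, where $(a_{k-1},\dots,a_0)$ is its label in $D_{k-1,n}$, and its index within the copy is $uid_{k-1}=a_0+\sum_{l=1}^{k-1}a_l t_{l-1,n}$. For each pair $a<b$ of copy indices, one edge joins the vertex of $D^a_{k-1,n}$ with $uid_{k-1}=b-1$ to the vertex of $D^b_{k-1,n}$ with $uid_{k-1}=a$. $D_{k,n}$ is $(n+k-1)$-regular of even order for $k\geq1$. For a graph $G$ of even order, a matching preclusion set is an edge set $F$ such that $G-F$ has no perfect matching; $mp(G)$ is the minimum size of such a set, and such minimum sets are optimal. A trivial matching preclusion set is the set of all edges incident to one vertex. $G$ is super matched if $mp(G)=\delta(G)$ and every optimal matching preclusion set is trivial. *)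

(* Defs.v *)
From mathcomp Require Export all_boot.

Set Implicit Arguments.
Unset Strict Implicit.
Unset Printing Implicit Defensive.

(* A simple graph on a finite vertex type T is given by a symmetric and
   irreflexive adjacency relation e : rel T; an edge is a two-element set of
   vertices. *)
Section MatchingPreclusion.
Variables (T : finType) (e : rel T).

Definition edges : {set {set T}} :=
  [set [set p.1; p.2] | p : T * T & e p.1 p.2].

Definition incident_edges (v : T) : {set {set T}} :=
  [set A in edges | v \in A].

Definition degree (v : T) : nat := #|[set w | e v w]|.

(* The initial values #|T| here and #|edges| in mp only serve as upper bounds:
   no degree exceeds #|T|, and no preclusion set has more than #|edges|
   elements.  Both minima are genuine when T is nonempty (edges is then itself
   a matching preclusion set). *)
Definition min_degree : nat := \big[minn/#|T|]_(v : T) degree v.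

Definition perfect_matching (E M : {set {set T}}) : bool :=
  [&& M \subset E, trivIset M & cover M == [set: T]].

Definition matching_preclusion (F : {set {set T}}) : bool :=
  (F \subset edges) && ~~ [exists M, perfect_matching (edges :\: F) M].

Definition mp : nat :=
  \big[minn/#|edges|]_(F : {set {set T}} | matching_preclusion F) #|F|.

Definition optimal_preclusion (F : {set {set T}}) : bool :=
  matching_preclusion F && (#|F| == mp).

Definition trivial_preclusion (F : {set {set T}}) : Prop :=
  exists v : T, F = incident_edges v.

Definition super_matched : Prop :=
  mp = min_degree /\
  forall F : {set {set T}}, optimal_preclusion F -> trivial_preclusion F.

End MatchingPreclusion.

(* The vertex (a_k, ..., a_0) is encoded as the nested pair
   (a_k, (a_(k-1), (..., a_0))), and t_(k,n) is #|dcell_vertex n k|. *)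
Fixpoint dcell_vertex (n k : nat) : finType :=
  if k is k'.+1 then ('I_(#|dcell_vertex n k'|.+1) * dcell_vertex n k')%type
  else 'I_n.

(* uid (a_k, ..., a_0) = a_0 + \sum_(1 <= l <= k) a_l * t_(l-1,n) *)
Fixpoint uid (n k : nat) : dcell_vertex n k -> nat :=
  match k with
  | 0 => fun a : 'I_n => a : nat
  | k'.+1 => fun x : 'I_(#|dcell_vertex n k'|.+1) * dcell_vertex n k' =>
      uid x.2 + x.1 * #|dcell_vertex n k'|
  end.

(* The edge between copies x.1 < y.1, oriented from x to y. *)
Definition dcell_link (n k : nat)
    (x y : 'I_(#|dcell_vertex n k|.+1) * dcell_vertex n k) : bool :=
  [&& x.1 < y.1, uid x.2 == y.1 - 1 & uid y.2 == x.1].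

Fixpoint dcell (n k : nat) : rel (dcell_vertex n k) :=
  match k with
  | 0 => fun a b : 'I_n => a != b
  | k'.+1 => fun x y : 'I_(#|dcell_vertex n k'|.+1) * dcell_vertex n k' =>
      ((x.1 == y.1) && dcell x.2 y.2) || dcell_link x y || dcell_link y x
  end.

Lemma dcell_sym (n k : nat) : symmetric (@dcell n k).
Proof.
elim: k => [|k IHk] x y /=; first by rewrite eq_sym.
by rewrite eq_sym IHk -!orbA; congr (_ || _); rewrite orbC.
Qed.

Lemma dcell_irr (n k : nat) : irreflexive (@dcell n k).
Proof.
elim: k => [|k IHk] x /=; first by rewrite eqxx.
by rewrite IHk andbF /dcell_link ltnn.
Qed.

(* Main.v *)
(* D_k has a perfect matching made of all links (the edges joining two copies of
   D_(k-1)), so a preclusion set F of size at most deg D_k contains a link f.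
   For k >= 1 the graph D_k is a disjoint union of perfect matchings, hence it
   survives the removal of fewer than deg D_k edges; so some copy i of D_(k-1)
   contains deg D_(k-1) = deg D_k - 1 edges of F, and these together with f are
   all of F.  If F is not a star, one of its edges uz in copy i misses f; a
   perfect matching of copy i through uz and no other edge of F is then repaired
   by replacing uz with the links at u and z and closing up through other copies.
   The last part needs each copy D_(k-1) minus any two vertices to have a perfect
   matching, which is true for k-1 >= 1 except when D_(k-1) is the hexagon
   D_(1,2); the consequences of this exception (for D_(2,2) only) are settled by
   computation. *)

From mathcomp Require Import ssralg zmodp.
From mathcomp Require Import zify.
Require Import Defs.

Set Implicit Arguments.
Unset Strict Implicit.
Unset Printing Implicit Defensive.

(** * Matchings as involutions, and their elementary properties *)

Definition avoid (T : finType) (e : rel T) (F : {set {set T}}) : rel T :=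
  fun v w => e v w && ([set v; w] \notin F).

(** Here [m] is the partner map of a perfect matching of [S]; its values outside [S] are arbitrary,
    which makes gluing easy. *)
Definition matchable (T : finType) (e : rel T) (S : {set T}) :=
  exists m : T -> T,
    forall v, v \in S -> [/\ m v \in S, e v (m v) & m (m v) = v].

Definition bicritical (T : finType) (e : rel T) :=
  forall u w, u != w -> matchable e (~: [set u; w]).

(* d pairwise disjoint perfect matchings m c: injectivity in c says that no edge
   lies in two of them. *)
Definition factorable (T : finType) (e : rel T) (d : nat) :=
  exists (I : finType) (m : I -> T -> T),
    [/\ #|I| = d, forall c v, e v (m c v), forall c, involutive (m c)
      & forall v, injective (m^~ v)].

(* With d the degree of e, this is the nontrivial inequality of super-matchedness. *)
Definition super (T : finType) (e : rel T) (d : nat) :=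
  forall F : {set {set T}}, F \subset edges e -> #|F| <= d ->
    ~ matchable (avoid e F) [set: T] ->
  exists v, incident_edges e v \subset F.

Lemma matchable_mono (T : finType) (e e' : rel T) (S : {set T}) :
  (forall v w, e v w -> e' v w) -> matchable e S -> matchable e' S.
Proof.
by move=> ee' [m mP]; exists m => v /mP [? /ee' ? ?]; split.
Qed.

Lemma matchable0 (T : finType) (e : rel T) : matchable e set0.
Proof. by exists id => v; rewrite inE. Qed.

Lemma matchableU2 (T : finType) (e : rel T) (S : {set T}) u w :
  symmetric e -> e u w -> u != w -> u \notin S -> w \notin S ->
  matchable e S -> matchable e (u |: (w |: S)).
Proof.
move=> e_sym euw uw uS wS [m mP].
exists (fun v => if v == u then w else if v == w then u else m v) => v.
rewrite !inE; have [->|vu] := eqVneq v u.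
  by move=> _; rewrite (eq_sym w) (negPf uw) !eqxx.
have [->|vw] := eqVneq v w; first by move=> _; rewrite !eqxx e_sym.
move=> /= /mP [mS em mK]; split; rewrite ?mS ?orbT //.
have [E|_] := eqVneq (m v) u; first by rewrite -E mS in uS.
by have [E|//] := eqVneq (m v) w; rewrite -E mS in wS.
Qed.

Lemma set2_inj (T : finType) (u v w : T) : [set u; v] = [set u; w] -> v = w.
Proof.
move=> E.
have /set2P[vu|//] : v \in [set u; w] by rewrite -E set22.
have /set2P[wu|//] : w \in [set u; v] by rewrite E set22.
by rewrite vu wu.
Qed.

Lemma edgesE (T : finType) (e : rel T) (A : {set T}) :
  reflect (exists v w, e v w /\ A = [set v; w]) (A \in edges e).
Proof.
apply: (iffP imsetP) => [[[v w]]|[v [w [evw ->]]]].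
  by rewrite inE /= => evw ->; exists v, w.
by exists (v, w); rewrite ?inE.
Qed.

Lemma mem_edges (T : finType) (e : rel T) v w :
  e v w -> [set v; w] \in edges e.
Proof. by move=> evw; apply/edgesE; exists v, w. Qed.

(** Pigeonhole: if every factor met [F], choosing one such edge per factor would embed the [d]
    edge-disjoint factors into [F]. *)
Lemma factorable_avoid (T : finType) (e : rel T) d (F : {set {set T}}) :
  factorable e d -> #|F| < d -> matchable (avoid e F) [set: T].
Proof.
move=> [I [m [<- em mK m_inj]]] ltFd.
have [/existsP[c /forallP mc]|/existsPn hit] :=
    boolP [exists c : I, forall v, [set v; m c v] \notin F].
  by exists (m c) => v _; rewrite inE /avoid em mc mK.
have {}hit c : exists v, [set v; m c v] \in F.
  by have /forallPn[v] := hit c; rewrite negbK; exists v.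
have [g gF] := fin_all_exists hit.
suff g_inj : {in I &, injective (fun c => [set g c; m c (g c)])}.
  have := leq_trans ltFd (eq_leq (esym (card_in_imset g_inj))).
  rewrite ltnNge => /negP[]; apply/subset_leq_card/subsetP.
  by move=> _ /imsetP[c _ ->].
move=> c c' _ _ E.
(* The common edge is read from the same end in both factors or from opposite ends; the second case
   is turned around by [mK]. *)
have [gE|gE] : g c = g c' \/ g c = m c' (g c').
- by apply/set2P; rewrite -E set21.
- by apply: (m_inj (g c)); move: E; rewrite -gE => /set2_inj.
apply: (m_inj (g c')); rewrite -gE; apply/esym/(canRL (mK c)).
have /set2P[E'|->//] : g c' \in [set g c; m c (g c)] by rewrite E set21.
by move: E; rewrite -gE E' => /set2_inj.
Qed.

Lemma complete_matchable (T : finType) (S : {set T}) :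
  ~~ odd #|S| -> matchable (fun v w => v != w) S.
Proof.
have [n] := ubnP #|S|; elim: n S => // n IHn S leSn evenS.
have [->|[u uS]] := set_0Vmem S; first exact: matchable0.
have cS := cardsD1 u S; rewrite uS in cS.
have [S0|[w wS]] := set_0Vmem (S :\ u); first by move: evenS; rewrite cS S0 cards0.
have cSu := cardsD1 w (S :\ u); rewrite wS in cSu.
have /setD1P[wu wS'] := wS.
rewrite -(setD1K uS) -(setD1K wS); apply: matchableU2.
- by move=> x y; rewrite eq_sym.
- by rewrite eq_sym.
- by rewrite eq_sym.
- by rewrite !inE eqxx andbF.
- by rewrite !inE eqxx.
by apply: IHn; move: evenS leSn; rewrite cS cSu /= ?negbK //; lia.
Qed.

Lemma complete_bicritical (T : finType) :
  ~~ odd #|T| -> bicritical (fun v w : T => v != w).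
Proof.
move=> evenT u w uw; apply: complete_matchable.
by rewrite -(cardsC [set u; w]) cards2 uw oddD in evenT.
Qed.

(** * Factorizations of complete graphs *)

(* The x-th near-perfect matching of K_n, n odd, is v |-> 2x - v modulo n. *)
Section NearFactor.
Import GRing.Theory.
Local Open Scope ring_scope.

(** The modulus [p.+1] is odd, so 2 is invertible, with inverse [p./2.+1]. *)
Lemma Zp_double_inj p (x y : 'I_p.+1) : ~~ odd p -> x + x = y + y -> x = y.
Proof.
move=> evenp xy.
have half (z : 'I_p.+1) : z = (z + z) *+ (p./2.+1).
  rewrite -mulr2n -mulrnA.
  have -> : (2 * p./2.+1 = p.+1 + 1)%N by have := odd_double_half p; lia.
  rewrite mulrnDr mulr1n Zp_mulrn.
  have -> : inZp (z * p.+1) = 0 :> 'I_p.+1 by apply: val_inj; rewrite /= modnMl.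
  by rewrite add0r.
by rewrite (half x) (half y) xy.
Qed.

Lemma near_factorization n : odd n ->
  exists nu : 'I_n -> 'I_n -> 'I_n,
    [/\ forall x, involutive (nu x), forall x v, (nu x v == v) = (v == x)
      & forall v, injective (nu^~ v)].
Proof.
case: n => // p /= evenp; exists (fun x v => x + x - v); split.
- by move=> x v; rewrite opprB addrC subrK.
- move=> x v; rewrite subr_eq; apply/eqP/eqP => [|-> //].
  by move/(Zp_double_inj evenp).
- by move=> v x y /addIr; apply: Zp_double_inj.
Qed.

End NearFactor.

Lemma factorable_bij (T T' : finType) (f : T -> T') (e : rel T) (e' : rel T') d :
  bijective f -> (forall v w, e v w = e' (f v) (f w)) ->
  factorable e' d -> factorable e d.
Proof.
move=> [g fK gK] ee' [I [m [cI em mK m_inj]]].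
exists I, (fun c v => g (m c (f v))); split=> //.
- by move=> c v; rewrite ee' gK.
- by move=> c v; rewrite gK mK fK.
by move=> v c c' /(can_inj gK) /m_inj.
Qed.

(** A point at infinity, [None], is added to the integers modulo [n]: the factor of colour [c] is
    the near-perfect matching [nu c], completed by joining its fixed point [c] to infinity. *)
Lemma complete_factorable (T : finType) n : odd n -> #|T| = n.+1 ->
  factorable (fun v w : T => v != w) n.
Proof.
move=> oddn cT.
have [nu [nuK nuE nu_inj]] := near_factorization oddn.
have [f bf] : exists f : T -> option 'I_n, bijective f.
  have E : #|T| = #|{: option 'I_n}| by rewrite cT card_option card_ord.
  exists (enum_val \o (cast_ord E \o enum_rank)).
  apply/bij_comp/bij_comp; [exact: enum_val_bij | | exact: enum_rank_bij].
  by exists (cast_ord (esym E)); [exact: cast_ordK | exact: cast_ordKV].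
apply: (@factorable_bij _ _ f _ (fun v w => v != w)) => //.
  by move=> v w; rewrite (bij_eq bf).
exists 'I_n, (fun c v => if v is Some v' then
    (if v' == c then None else Some (nu c v')) else Some c); split.
- by rewrite card_ord.
- move=> c [v|] //; have [//|vc] := eqVneq v c.
  by rewrite eq_sym (inj_eq Some_inj) nuE.
- move=> c [v|] /=; last by rewrite eqxx.
  have [-> //|vc] := eqVneq v c.
  have [E|_] := eqVneq (nu c v) c; last by rewrite nuK.
  have Ec : nu c c = c by apply/eqP; rewrite nuE.
  by case/eqP: vc; rewrite -(nuK c v) E Ec.
- move=> [v|] c c'; last by case.
  have [vc|_] := eqVneq v c; have [vc'|_] := eqVneq v c' => //.
    by rewrite -vc -vc'.
  by case=> /nu_inj.
Qed.

(** * Stars, and lists of links *)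

Lemma incident_edgesP (T : finType) (e : rel T) v A :
  symmetric e ->
  reflect (exists2 w, e v w & A = [set v; w]) (A \in incident_edges e v).
Proof.
move=> e_sym; rewrite inE; apply: (iffP andP) => [[/edgesE[x [y [exy ->]]]]|].
  by case/set2P=> ->; [exists y | exists x; rewrite 1?e_sym // setUC].
by case=> w evw ->; rewrite set21 mem_edges.
Qed.

Lemma card_incident_edges (T : finType) (e : rel T) v :
  symmetric e -> #|incident_edges e v| = degree e v.
Proof.
move=> e_sym; rewrite /degree.
rewrite -(@card_in_imset _ _ (fun w => [set v; w])); last first.
  by move=> w w' _ _; apply: set2_inj.
apply: eq_card => A; apply/incident_edgesP/imsetP => // -[w].
  by move=> evw ->; exists w; rewrite ?inE.
by rewrite inE => evw ->; exists w.
Qed.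

Lemma exists_notin (T : finType) (A : {set T}) : #|A| < #|T| -> exists x, x \notin A.
Proof.
move=> ltA; apply/existsP; rewrite -negb_forall; apply/negP => /forallP inA.
by move: ltA; rewrite ltnNge -cardsT subset_leq_card //; apply/subsetP.
Qed.

Definition linked (T : eqType) (s : seq (T * T)) : rel T :=
  fun x y => ((x, y) \in s) || ((y, x) \in s).

Lemma linked_sym (T : eqType) (s : seq (T * T)) : symmetric (linked s).
Proof. by move=> x y; rewrite /linked orbC. Qed.

(** * Joining copies of a graph by one link per pair of copies *)

(* The link at vertex v of copy j goes to copy target j v; conversely port j l is
   the vertex of copy j linked to copy l (junk when l = j). *)
Section Copies.

Variables (C V : finType) (target : C -> V -> C) (port : C -> C -> V).
Hypothesis target_neq : forall j v, target j v != j.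
Hypothesis portK : forall j l, l != j -> target j (port j l) = l.
Hypothesis targetK : forall j v, port j (target j v) = v.

Variables (e : rel V) (E : rel (C * V)).

Definition partner (x : C * V) : C * V :=
  (target x.1 x.2, port (target x.1 x.2) x.1).

Hypothesis EE : forall x y,
  E x y = (x.1 == y.1) && e x.2 y.2 || (y == partner x).

Lemma target_eq j l v : l != j -> (target j v == l) = (v == port j l).
Proof. by move=> lj; apply/eqP/eqP => [<-|->]; rewrite ?targetK ?portK. Qed.

Lemma target_inj j : injective (target j).
Proof. by move=> v w vw; rewrite -(targetK j v) vw targetK. Qed.

Lemma partnerK : involutive partner.
Proof. by case=> j v; rewrite /partner /= portK 1?eq_sym // targetK. Qed.

Lemma edge_partner x : E x (partner x).
Proof. by rewrite EE eqxx orbT. Qed.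

Lemma edge_copy j v w : E (j, v) (j, w) = e v w.
Proof.
by rewrite EE eqxx /= /partner /= xpair_eqE eq_sym (negPf (target_neq _ _)) orbF.
Qed.

(* H selects the links to be used; what is left of each copy must be matchable. *)
Lemma glue (E' : rel (C * V)) (S : {set C * V}) (H : rel C) :
  symmetric H ->
  (forall j v, H j (target j v) -> (j, v) \in S /\ E' (j, v) (partner (j, v))) ->
  (forall j, matchable (fun v w => E' (j, v) (j, w))
               [set v | ((j, v) \in S) && ~~ H j (target j v)]) ->
  matchable E' S.
Proof.
move=> H_sym links /fin_all_exists[m mP].
have H_partner j v : H j (target j v) ->
    H (target j v) (target (target j v) (port (target j v) j)).
  by rewrite portK 1?H_sym // eq_sym.
exists (fun x => if H x.1 (target x.1 x.2) then partner x else (x.1, m x.1 x.2)).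
case=> j v vS /=; case: ifPn => [Hj|Hj].
  have [_ Ej] := links _ _ Hj; have [pS _] := links _ _ (H_partner _ _ Hj).
  by rewrite H_partner //; split=> //; apply: partnerK.
have [] := mP j v; first by rewrite inE vS.
by rewrite inE => /andP[mS mH] em mK; rewrite (negPf mH) mK.
Qed.

Lemma glue_step (S : {set C * V}) (H : rel C) :
  symmetric H ->
  (forall j v, H j (target j v) -> (j, v) \in S) ->
  (forall j, matchable e [set v | ((j, v) \in S) && ~~ H j (target j v)]) ->
  matchable E S.
Proof.
move=> H_sym links copies; apply: (glue H_sym) => [j v /links|j].
  by split=> //; apply: edge_partner.
by apply: matchable_mono (copies j) => v w; rewrite edge_copy.
Qed.

Lemma degree_step j v : degree E (j, v) = (degree e v).+1.
Proof.
rewrite /degree; have -> : [set y | E (j, v) y] =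
    partner (j, v) |: [set (j, w) | w in [set w | e v w]].
  apply/setP=> -[l w]; rewrite !inE EE /= orbC; congr (_ || _).
  apply/andP/imsetP => [[/eqP<- evw]|[w' + [-> ->]]]; last by rewrite inE eqxx.
  by exists w; rewrite ?inE.
rewrite cardsU1 card_imset; last by move=> ? ? [].
rewrite (_ : _ \notin _ = true) //; apply/imsetP => -[w _ [+ _]].
by apply/eqP; exact: target_neq.
Qed.

(** The set of all links is one further perfect matching, disjoint from those inside the copies. *)
Lemma factorable_step d : factorable e d -> factorable E d.+1.
Proof.
move=> [I [m [<- em mK m_inj]]].
exists (option I), (fun c x => if c is Some c then (x.1, m c x.2) else partner x).
split.
- by rewrite card_option.
- by move=> [c|] [j v]; rewrite ?edge_copy ?edge_partner.
- by move=> [c|] [j v] /=; rewrite ?mK ?partnerK.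
have no j v c : partner (j, v) <> (j, m c v).
  by case=> /eqP; rewrite (negPf (target_neq _ _)).
move=> [j v] [c|] [c'|] //=; first by case=> /m_inj ->.
  by move/esym/no.
by move/no.
Qed.

(* The pi_c-th matching joins copy j to copy pi_c j by a link and, inside copy
   j, uses the near-perfect matching that misses the end of this link. *)
Lemma factorable_odd d (nu : V -> V -> V) :
  (forall x, involutive (nu x)) -> (forall x v, (nu x v == v) = (v == x)) ->
  (forall v, injective (nu^~ v)) -> (forall v w, v != w -> e v w) ->
  factorable (fun j l : C => j != l) d -> factorable E d.
Proof.
move=> nuK nuE nu_inj e_complete [I [p [cI pE pK p_inj]]].
exists I, (fun c x => if target x.1 x.2 == p c x.1 then partner x
                      else (x.1, nu (port x.1 (p c x.1)) x.2)).
have p_neq c j : p c j != j by rewrite eq_sym pE.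
have nuxx x : nu x x = x by apply/eqP; rewrite nuE.
(* The end of the link is the only fixed point of the near-perfect matching, so the latter permutes
   the vertices that do not use the link. *)
have nu_target c j v :
    (target j (nu (port j (p c j)) v) == p c j) = (target j v == p c j).
  rewrite !target_eq //; apply/eqP/eqP => [nuv|->]; last exact: nuxx.
  by rewrite -(nuK (port j (p c j)) v) nuv nuxx.
split=> //.
- move=> c [j v] /=; case: ifPn => [_|tv]; first exact: edge_partner.
  by rewrite edge_copy e_complete // eq_sym nuE -target_eq.
- move=> c [j v] /=; have [tv|tv] := eqVneq (target j v) (p c j).
    rewrite /= portK 1?eq_sym // tv pK eqxx.
    exact: (partnerK (j, v)).
  by rewrite /= nu_target (negPf tv) nuK.
move=> [j v] c c' /=; case: ifPn => [/eqP tv|tv]; case: ifPn => [/eqP tv'|tv'].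
- by move=> _; apply: (p_inj j); rewrite /= -tv -tv'.
- by case=> /eqP; rewrite (negPf (target_neq _ _)).
- by case=> /esym/eqP; rewrite (negPf (target_neq _ _)).
case=> /nu_inj port_eq; apply: (p_inj j).
by rewrite /= -(portK (p_neq c j)) port_eq portK.
Qed.

(** * Bicriticality of the joined graph *)

(** Links are chosen so that every copy loses no vertex or two. For removed vertices in distinct
    copies [a] and [b] the link between them does this, unless it ends at a removed vertex; then a
    detour through a third copy [c] is taken. *)
Lemma bicritical_step :
  2 < #|V| -> #|V| < #|C| -> matchable e [set: V] -> bicritical e ->
  bicritical E.
Proof.
move=> V3 VC e_all e_bi [a p] [b q]; rewrite xpair_eqE.
have [<-{b} /= pq|ab _] := eqVneq a b.
  apply: (@glue_step _ (fun _ _ => false)) => // j.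
  have [->|ja] := eqVneq j a.
    rewrite (_ : [set v | _] = ~: [set p; q]); first exact: e_bi.
    by apply/setP=> v; rewrite !inE !xpair_eqE eqxx /= ?andbT.
  rewrite (_ : [set v | _] = setT) //.
  by apply/setP=> v; rewrite !inE !xpair_eqE (negPf ja).
have ba : b != a by rewrite eq_sym.
have [/andP[pb qa]|direct] := boolP ((target a p != b) && (target b q != a)).
  apply: (@glue_step _ (linked [:: (a, b)])) => [|j v|j].
  - exact: linked_sym.
  - rewrite /linked !inE !xpair_eqE => /orP[].
      case/andP=> /eqP-> /eqP tv; rewrite eqxx (negPf ab) /= orbF.
      by apply: contra_neq pb => <-.
    rewrite andbC => /andP[/eqP-> /eqP tv]; rewrite eqxx (negPf ba) /=.
    by apply: contra_neq qa => <-.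
  have [->|ja] := eqVneq j a.
    rewrite (_ : [set v | _] = ~: [set p; port a b]).
      by apply: e_bi; rewrite -target_eq.
    apply/setP=> v; rewrite /linked !inE !xpair_eqE eqxx (negPf ab) /= orbF andbF orbF.
    by rewrite target_eq // negb_or.
  have [->|jb] := eqVneq j b.
    rewrite (_ : [set v | _] = ~: [set q; port b a]).
      by apply: e_bi; rewrite -target_eq.
    apply/setP=> v; rewrite /linked !inE !xpair_eqE eqxx (negPf ba) /=.
    by rewrite andbT target_eq // negb_or.
  rewrite (_ : [set v | _] = setT) //.
  by apply/setP=> v; rewrite /linked !inE !xpair_eqE (negPf ja) (negPf jb) !andbF.
(* One of the two targets is already [a] or [b], so at most three of the at least four copies are
   excluded. *)
have [c] : exists c, c \notin [set a; b; target a p; target b q].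
  apply: exists_notin; apply: leq_ltn_trans (leq_ltn_trans V3 VC).
  move: direct; rewrite negb_and !negbK => /orP[]/eqP->.
    rewrite (_ : [set _; _; _; _] = [set a; b; target b q]).
      by rewrite -setUA cardsU1 cards2; case: (_ \notin _); case: (_ != _).
    by apply/setP=> x; rewrite !inE; do 3!case: eqP.
  rewrite (_ : [set _; _; _; _] = [set a; b; target a p]).
    by rewrite -setUA cardsU1 cards2; case: (_ \notin _); case: (_ != _).
  by apply/setP=> x; rewrite !inE; do 3!case: eqP.
rewrite !inE !negb_or -!andbA => /and4P[ca cb pc qc].
have [ac bc] : a != c /\ b != c by rewrite !(eq_sym _ c).
apply: (@glue_step _ (linked [:: (a, c); (c, b)])) => [|j v|j].
- exact: linked_sym.
- rewrite /linked !inE !xpair_eqE -!orbA => /or4P[].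
  + case/andP=> /eqP-> /eqP tv; rewrite eqxx (negPf ab) /= orbF.
    by apply: contra_neq pc => <-; rewrite tv.
  + by case/andP=> /eqP-> _; rewrite (negPf ca) (negPf cb).
  + by case/andP=> _ /eqP->; rewrite (negPf ca) (negPf cb).
  rewrite andbC => /andP[/eqP-> /eqP tv]; rewrite eqxx (negPf ba) /=.
  by apply: contra_neq qc => <-; rewrite tv.
have [->|ja] := eqVneq j a.
  rewrite (_ : [set v | _] = ~: [set p; port a c]).
    by apply: e_bi; rewrite -target_eq // eq_sym.
  apply/setP=> v; rewrite /linked !inE !xpair_eqE eqxx (negPf ab) (negPf ac) /=.
  by rewrite ?andbF ?orbF -target_eq // negb_or.
have [->|jb] := eqVneq j b.
  rewrite (_ : [set v | _] = ~: [set q; port b c]).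
    by apply: e_bi; rewrite -target_eq // eq_sym.
  apply/setP=> v; rewrite /linked !inE !xpair_eqE eqxx (negPf ba) (negPf bc) /=.
  by rewrite andbF andbT -target_eq //= negb_or.
have [->|jc] := eqVneq j c.
  rewrite (_ : [set v | _] = ~: [set port c a; port c b]).
    by apply: e_bi; rewrite -target_eq // portK // eq_sym.
  apply/setP=> v; rewrite /linked !inE !xpair_eqE eqxx (negPf ca) (negPf cb) /=.
  by rewrite -!target_eq //; rewrite andbT andbF orbF orbC.
rewrite (_ : [set v | _] = setT) //.
apply/setP=> v; rewrite /linked !inE !xpair_eqE (negPf ja) (negPf jb) (negPf jc).
by rewrite !andbF.
Qed.

(** A complete copy of odd order is matchable after losing an odd number of vertices. The copies not
    containing a removed vertex are paired off by links, each losing one vertex. If both removed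
    vertices lie in copy [a], a link at a third vertex [x] makes the loss of [a] odd, and its other
    end [c] is left out of the pairing. *)
Lemma bicritical_odd :
  odd #|V| -> 2 < #|V| -> #|C| = #|V|.+1 -> (forall v w, v != w -> e v w) ->
  bicritical E.
Proof.
move=> oddV V3 cC e_complete [a p] [b q]; rewrite xpair_eqE.
have copyP (A : {set V}) : odd #|A| -> matchable e (~: A).
  move=> oddA; apply: matchable_mono e_complete _.
  by apply: complete_matchable; move: oddV; rewrite -(cardsC A) oddD oddA.
have copy1 v : matchable e (~: [set v]) by apply: copyP; rewrite cards1.
have others c d : c != d -> exists m : C -> C,
    forall j, j \notin [set c; d] ->
      [/\ m j \notin [set c; d], j != m j & m (m j) = j].
  move=> cd; have [|m mP] := @complete_matchable C (~: [set c; d]).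
    have : ~~ odd #|C| by rewrite cC /= negbK.
    by rewrite -(cardsC [set c; d]) cards2 cd oddD.
  by exists m => j jcd; have [] := mP j; rewrite !inE // in jcd *.
have [<-{b} /= pq|ab _] := eqVneq a b.
  have [x] : exists x, x \notin [set p; q].
    by apply: exists_notin; rewrite cards2; case: (_ != _) => //; apply: ltnW.
  rewrite !inE negb_or => /andP[xp xq]; have ca := target_neq a x.
  set c := target a x in ca; have ac : a != c by rewrite eq_sym.
  have [m mP] := others _ _ ac.
  pose H j l := (j \notin [set a; c]) && (l == m j) || linked [:: (a, c)] j l.
  apply: (@glue_step _ H) => [j l|j v|j].
  - rewrite /H linked_sym; congr (_ || _).
    by apply/andP/andP => -[] /mP[? ? mK] /eqP->; rewrite mK.
  - rewrite /H /linked !inE !xpair_eqE negb_or => /or3P[].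
    + by case/andP=> /andP[/negPf->].
    + case/andP=> /eqP-> /eqP; rewrite eqxx => /target_inj ->.
      by rewrite (negPf xp) (negPf xq).
    by case/andP=> _ /eqP->; rewrite (negPf ca).
  have [->|ja] := eqVneq j a.
    rewrite (_ : [set v | _] = ~: [set p; q; x]).
      apply: copyP; rewrite setUC cardsU1 cards2 pq !inE negb_or xp xq.
      by [].
    apply/setP=> v; rewrite /H /linked !inE !xpair_eqE !eqxx (negPf ac) /=.
    by rewrite andbF orbF (inj_eq (@target_inj a)) !negb_or.
  have [->|jc] := eqVneq j c.
    rewrite (_ : [set v | _] = ~: [set port c a]) //.
    apply/setP=> v; rewrite /H /linked !inE !xpair_eqE !eqxx (negPf ca) /=.
    by rewrite andbT target_eq.
  have [_ + _] : [/\ m j \notin [set a; c], j != m j & m (m j) = j].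
    by apply: mP; rewrite !inE negb_or ja.
  rewrite eq_sym => mj; rewrite (_ : [set v | _] = ~: [set port j (m j)]) //.
  apply/setP=> v; rewrite /H /linked !inE !xpair_eqE (negPf ja) (negPf jc) /=.
  by rewrite andbF orbF target_eq.
have [m mP] := others _ _ ab.
pose H j l := (j \notin [set a; b]) && (l == m j).
apply: (@glue_step _ H) => [j l|j v|j].
- by apply/andP/andP => -[] /mP[? ? mK] /eqP->; rewrite mK.
- rewrite /H !inE !xpair_eqE negb_or => /andP[/andP[/negPf-> /negPf->]].
  by [].
have [->|ja] := eqVneq j a.
  rewrite (_ : [set v | _] = ~: [set p]) //.
  by apply/setP=> v; rewrite /H !inE !xpair_eqE !eqxx (negPf ab) /= orbF andbT.
have [->|jb] := eqVneq j b.
  rewrite (_ : [set v | _] = ~: [set q]) //.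
  apply/setP=> v; rewrite /H !inE !xpair_eqE !eqxx eq_sym (negPf ab) orbT /=.
  by rewrite andbT.
have [_ + _] : [/\ m j \notin [set a; b], j != m j & m (m j) = j].
  by apply: mP; rewrite !inE negb_or ja.
rewrite eq_sym => mj; rewrite (_ : [set v | _] = ~: [set port j (m j)]) //.
apply/setP=> v; rewrite /H !inE !xpair_eqE (negPf ja) (negPf jb) /=.
by rewrite target_eq.
Qed.

(* A set H of links, avoiding the link between copies g and h, which meets copy i
   exactly in u and z and leaves the rest of every other copy matchable. *)
Definition detour (i : C) (u z : V) (g h : C) :=
  exists H : rel C,
    [/\ symmetric H, forall v, H i (target i v) = (v \in [set u; z]), ~~ H g h
      & forall j, j != i -> matchable e [set v | ~~ H j (target j v)]].

(** In the application [F] is the part inside copy [i] of a preclusion set whose only other edge is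
    the link between [g] and [h]. The last hypothesis keeps these edges from containing a star of
    the joined graph. *)
Definition detourable (d : nat) :=
  forall (i g h : C) (F : {set {set V}}),
    F \subset edges e -> #|F| = d -> ~ matchable (avoid e F) [set: V] -> g != h ->
    (forall x, linked [:: (g, h)] i (target i x) -> ~~ (incident_edges e x \subset F)) ->
  exists u z, [/\ [set u; z] \in F, u != z & detour i u z g h].

(** The cycle of copies [i], [b], [c] takes two vertices from each, and bicriticality matches the
    rest. If the link from [b] to [c] is the forbidden one, a fourth copy [p] is inserted between
    them. *)
Lemma bicritical_detour i u z g h :
  3 < #|C| -> matchable e [set: V] -> bicritical e -> u != z ->
  ~~ linked [:: (g, h)] i (target i u) -> ~~ linked [:: (g, h)] i (target i z) ->
  detour i u z g h.
Proof.
move=> C4 e_all e_bi uz; set b := target i u; set c := target i z => ghb ghc.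
have ib : i != b by rewrite eq_sym target_neq.
have ic : i != c by rewrite eq_sym target_neq.
have bc : b != c by rewrite (inj_eq (@target_inj i)).
have [bi ci cb] : [/\ b != i, c != i & c != b] by split; rewrite eq_sym.
have targetb v : (target i v == b) = (v == u) by rewrite (inj_eq (@target_inj i)).
have targetc v : (target i v == c) = (v == z) by rewrite (inj_eq (@target_inj i)).
have ghsym x y : linked [:: (g, h)] x y = ((x == g) && (y == h)) || ((y == g) && (x == h)).
  by rewrite /linked !inE !xpair_eqE.
have [bcgh|ghbc] := boolP (linked [:: (g, h)] b c); last first.
  exists (linked [:: (i, b); (b, c); (c, i)]); split; first exact: linked_sym.
  - move=> v; rewrite /linked !inE !xpair_eqE !eqxx (negPf ib) (negPf ic) /=.
    by rewrite ?andbF ?andbT ?orbF targetb targetc.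
  - move: ghb ghc ghbc; rewrite /linked !inE !xpair_eqE !(eq_sym _ g) !(eq_sym _ h).
    by do 6!case: (_ == _).
  move=> j ji; have [->|jb] := eqVneq j b.
    rewrite (_ : [set v | _] = ~: [set port b i; port b c]).
      by apply: e_bi; rewrite -target_eq // portK.
    apply/setP=> v; rewrite /linked !inE !xpair_eqE !eqxx (negPf bi) (negPf bc) /=.
    by rewrite -!target_eq // ?andbF ?andbT ?orbF orbC.
  have [->|jc] := eqVneq j c.
    rewrite (_ : [set v | _] = ~: [set port c i; port c b]).
      by apply: e_bi; rewrite -target_eq // portK.
    apply/setP=> v; rewrite /linked !inE !xpair_eqE !eqxx (negPf ci) (negPf cb) /=.
    by rewrite -!target_eq // ?andbF ?andbT ?orbF.
  rewrite (_ : [set v | _] = setT) //.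
  apply/setP=> v; rewrite /linked !inE !xpair_eqE (negPf ji) (negPf jb) (negPf jc).
  by rewrite !andbF.
have [p] : exists p, p \notin [set i; b; c].
  apply: exists_notin; apply: leq_ltn_trans C4.
  by rewrite -setUA cardsU1 cards2; case: (_ \notin _); case: (_ != _).
rewrite !inE !negb_or -!andbA => /and3P[pi pb pc].
have [ip bp cp] : [/\ i != p, b != p & c != p] by split; rewrite eq_sym.
exists (linked [:: (i, b); (b, p); (p, c); (c, i)]); split; first exact: linked_sym.
- move=> v; rewrite /linked !inE !xpair_eqE !eqxx (negPf ib) (negPf ic) (negPf ip) /=.
  by rewrite ?andbF ?andbT ?orbF targetb targetc.
- move: bcgh; rewrite ghsym => /orP[]/andP[/eqP<- /eqP<-];
  rewrite /linked !inE !xpair_eqE !eqxx (negPf bc) (negPf cb) (negPf bi) (negPf ci);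
  by rewrite ?(negPf bp) ?(negPf cp) ?andbF.
move=> j ji; have [->|jb] := eqVneq j b.
  rewrite (_ : [set v | _] = ~: [set port b i; port b p]).
    by apply: e_bi; rewrite -target_eq // portK.
  apply/setP=> v; rewrite /linked !inE !xpair_eqE !eqxx (negPf bi) (negPf bc) (negPf bp) /=.
  by rewrite -!target_eq // ?andbF ?andbT ?orbF orbC.
have [->|jc] := eqVneq j c.
  rewrite (_ : [set v | _] = ~: [set port c i; port c p]).
    by apply: e_bi; rewrite -target_eq // portK.
  apply/setP=> v; rewrite /linked !inE !xpair_eqE !eqxx (negPf ci) (negPf cb) (negPf cp) /=.
  by rewrite -!target_eq // ?andbF ?andbT ?orbF.
have [->|jp] := eqVneq j p.
  rewrite (_ : [set v | _] = ~: [set port p b; port p c]).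
    by apply: e_bi; rewrite -target_eq // portK.
  apply/setP=> v; rewrite /linked !inE !xpair_eqE !eqxx (negPf pi) (negPf pb) (negPf pc) /=.
  by rewrite -!target_eq // ?andbF ?andbT ?orbF orbC.
rewrite (_ : [set v | _] = setT) //.
apply/setP=> v; rewrite /linked !inE !xpair_eqE (negPf ji) (negPf jb) (negPf jc) (negPf jp).
by rewrite !andbF.
Qed.

(** At most one vertex [x] of copy [i] is an end of the forbidden link. As [F] has the size of a
    star but is not the star of [x], some edge of [F] avoids [x]. *)
Lemma bicritical_detourable d :
  0 < d -> symmetric e -> irreflexive e -> (forall v, degree e v = d) ->
  3 < #|C| -> matchable e [set: V] -> bicritical e -> detourable d.
Proof.
move=> d0 e_sym e_irr e_deg C4 e_all e_bi i g h F Fe cF _ gh nontriv.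
suff [A AF AP] : exists2 A, A \in F &
    forall x, x \in A -> ~~ linked [:: (g, h)] i (target i x).
  have /edgesE[u [z [euz Auz]]] := subsetP Fe _ AF.
  have uz : u != z by apply: contraTneq euz => ->; rewrite e_irr.
  exists u, z; rewrite -Auz; split=> //.
  by apply: bicritical_detour => //; apply: AP; rewrite Auz ?set21 ?set22.
have [/existsP[x ghx]|/existsPn free] := boolP [exists x, linked [:: (g, h)] i (target i x)].
  have ghx_uniq y : linked [:: (g, h)] i (target i y) -> y = x.
    move: ghx; rewrite /linked !inE !xpair_eqE => /orP[]/andP[/eqP E1 /eqP E2];
      case/orP=> /andP[/eqP E3 /eqP E4]; apply: (@target_inj i);
      by [congruence | case/eqP: gh; congruence].
  have [/subsetP sub|/subsetPn[A AF AP]] := boolP (F \subset incident_edges e x).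
    case/negP: (nontriv _ ghx); have /eqP-> // : F == incident_edges e x.
    by rewrite eqEcard card_incident_edges // e_deg cF leqnn andbT; apply/subsetP.
  exists A => // y yA; apply: contra AP => /ghx_uniq yx.
  by rewrite inE (subsetP Fe) // -yx.
have [F0|[A AF]] := set_0Vmem F; first by rewrite -cF F0 cards0 in d0.
by exists A.
Qed.

(** * Super-matchedness of the joined graph *)

Lemma imset_copy2 (i : C) (u z : V) : pair i @: [set u; z] = [set (i, u); (i, z)].
Proof. by rewrite imsetU1 imset_set1. Qed.

Lemma link_not_copy x i (A : {set V}) : [set x; partner x] <> pair i @: A.
Proof.
move=> xA.
have /imsetP[v _ xi] : x \in pair i @: A by rewrite -xA set21.
have /imsetP[w _ pi] : partner x \in pair i @: A by rewrite -xA set22.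
by have := target_neq x.1 x.2; case: pi => -> _; rewrite xi eqxx.
Qed.

Lemma joined_sym : symmetric e -> symmetric E.
Proof.
move=> e_sym x y; rewrite !EE eq_sym e_sym; congr (_ || _).
by apply/eqP/eqP => ->; rewrite partnerK.
Qed.

(* A preclusion set F of size d.+1 must contain a link f, and must have d edges
   in some copy i, so it has no other edge.  Take an edge uz of F in copy i
   which misses f: by minimality of d, copy i has a perfect matching whose only
   edge in F is uz.  Drop uz and close up with a detour from u to z through the
   other copies. *)
Lemma super_step d :
  0 < d -> symmetric e -> irreflexive e -> factorable e d -> (forall v, degree e v = d) ->
  detourable d -> super E d.+1.
Proof.
move=> d0 e_sym e_irr e_fact e_deg e_det F Fe leF unmatchable.
have [/forallP noF|/forallPn[[g p]]] :=
    boolP [forall x, [set x; partner x] \notin F].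
  case: unmatchable; exists partner => x _.
  by rewrite inE /avoid edge_partner noF partnerK.
rewrite negbK; set h := target g p; set f := [set _; _] => fF.
have gh : g != h by rewrite eq_sym target_neq.
pose Fi i := [set A in edges e | pair i @: A \in F].
have Fi_avoid i v w : avoid e (Fi i) v w -> avoid E F (i, v) (i, w).
  rewrite /avoid edge_copy !inE imset_copy2 => /andP[evw].
  by rewrite mem_edges // evw.
have [/forallP small|/forallPn[i]] := boolP [forall i, #|Fi i| < d].
  case: unmatchable; apply: (@glue _ _ (fun _ _ => false)) => // j.
  rewrite (_ : [set v | _] = setT); last by apply/setP => v; rewrite !inE.
  by apply: matchable_mono (factorable_avoid e_fact (small j)) => v w /Fi_avoid.
rewrite -leqNgt => leFi.
have pair_inj : injective (pair i : V -> C * V) by move=> ? ? [].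
have fcopy : f \notin [set pair i @: A | A : {set V} in Fi i].
  by apply/imsetP => -[A _]; apply: link_not_copy.
have sub : f |: [set pair i @: A | A : {set V} in Fi i] \subset F.
  rewrite subUset sub1set fF; apply/subsetP=> _ /imsetP[A + ->].
  by rewrite inE => /andP[].
have cU : #|f |: [set pair i @: A | A : {set V} in Fi i]| = #|Fi i|.+1.
  by rewrite cardsU1 fcopy card_imset //; apply: imset_inj.
have FE : F = f |: [set pair i @: A | A : {set V} in Fi i].
  by apply/esym/eqP; rewrite eqEcard sub cU (leq_trans leF).
have cFi : #|Fi i| = d.
  by apply/eqP; rewrite eqn_leq leFi andbT -ltnS -cU -FE.
have off_f j v w : [set (j, v); (j, w)] <> f.
  move=> fE; have : (g, p) \in [set (j, v); (j, w)] by rewrite fE set21.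
  have : partner (g, p) \in [set (j, v); (j, w)] by rewrite fE set22.
  rewrite !inE !xpair_eqE /= -/h -!andb_orr => /andP[/eqP hj _] /andP[/eqP gj _].
  by move: gh; rewrite gj hj eqxx.
have off_copy j v w : j != i -> [set (j, v); (j, w)] \notin F.
  move=> ji; rewrite FE !inE negb_or; apply/andP; split; first exact/eqP/off_f.
  apply/imsetP => -[A _ AE].
  have /imsetP[x _ [/eqP]] : (j, v) \in pair i @: A by rewrite -AE set21.
  by rewrite (negPf ji).
have Fi_edges : Fi i \subset edges e by apply/subsetP => A; rewrite inE => /andP[].
(* The other copies contain no edge of [F], so a perfect matching surviving in copy [i] would extend
   to the whole graph without links. *)
have Fi_bad : ~ matchable (avoid e (Fi i)) [set: V].
  move=> Fi_m; apply: unmatchable.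
  apply: (@glue _ _ (fun _ _ => false)) => // j.
  rewrite (_ : [set v | _] = setT); last by apply/setP => v; rewrite !inE.
  have [->|ji] := eqVneq j i.
    by apply: matchable_mono Fi_m => v w /Fi_avoid.
  have e_all := factorable_avoid (F := Fi j) e_fact.
  apply: matchable_mono (e_all _) => [v w /Fi_avoid //|].
  rewrite (_ : Fi j = set0) ?cards0; last first.
    apply/setP => A; rewrite !inE; apply/negP => /andP[/edgesE[v [w [_ ->]]]].
    by rewrite imset_copy2 (negPf (off_copy _ _ _ ji)).
  by [].
have [/existsP[x Fx]|/existsPn triv] :=
    boolP [exists x, incident_edges E x \subset F]; first by exists x.
case: (e_det i g h (Fi i)) => // [x ghx|u [z [AF uz [H [H_sym Hi Hgh H_copy]]]]].
  (* If [f] ends at [x] in copy [i], the star of [(i, x)] is the star of [x] in the copy together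
     with [f]. *)
  have fx : [set (i, x); partner (i, x)] = f.
    move: ghx; rewrite /linked !inE !xpair_eqE => /orP[]/andP[/eqP E1 /eqP E2].
      have -> : x = p by apply: (@target_inj i); rewrite E2 /h E1.
      by rewrite E1.
    suff -> : (i, x) = partner (g, p) by rewrite partnerK setUC.
    by rewrite /partner /= -/h -E1 -E2 targetK.
  apply: contra (triv (i, x)) => /subsetP sub_x; apply/subsetP => A.
  case/incident_edgesP=> [|[j w]]; first exact: joined_sym.
  rewrite EE => /orP[/andP[/= /eqP<- exw] ->|/eqP-> ->]; last by rewrite fx.
  have : [set x; w] \in Fi i by apply: sub_x; apply/incident_edgesP => //; exists w.
  by rewrite inE imset_copy2 => /andP[].
have [|m mP] := factorable_avoid (F := Fi i :\ [set u; z]) e_fact.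
  by move: cFi; rewrite (cardsD1 [set u; z]) AF => <-.
have {}mP v : [/\ e v (m v), [set v; m v] \in Fi i -> [set v; m v] = [set u; z]
    & m (m v) = v].
  have [//|_ /andP[emv]] := mP v; rewrite in_setD1 negb_and negbK => mF mK.
  by split=> // vF; move: mF; rewrite vF orbF => /eqP.
(* Otherwise the matching would avoid all of [Fi i]. *)
have mu : m u = z.
  apply/eqP/negPn/negP => muz; apply: Fi_bad; exists m => v _.
  have [emv mF mK] := mP v; rewrite inE /avoid emv; split=> //=.
  apply/negP => /mF mA; case/negP: muz; apply/eqP.
  have /set2P[uv|uv] : u \in [set v; m v] by rewrite mA set21.
    by move: mA; rewrite -uv => /set2_inj.
  by move: mA; rewrite -uv setUC => /set2_inj; rewrite uv mK.
have mz : m z = u by rewrite -mu; case: (mP u).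
case: unmatchable; apply: (glue H_sym) => [j v Hjv|j].
  split; rewrite ?in_setT // /avoid edge_partner FE !inE negb_or /=; apply/andP; split.
    apply: contra Hgh => /eqP vf.
    have /set2P[E1|E1] : (j, v) \in f by rewrite -vf set21.
      by move: Hjv; case: E1 => -> ->.
    by move: Hjv; case: E1 => -> ->; rewrite H_sym portK // eq_sym.
  by apply/imsetP => -[A _]; apply: link_not_copy.
have [->|ji] := eqVneq j i; last first.
  rewrite (_ : [set v | _] = [set v | ~~ H j (target j v)]); last first.
    by apply/setP=> v; rewrite !inE.
  apply: matchable_mono (H_copy _ ji) => v w evw.
  by rewrite /avoid edge_copy evw off_copy.
exists m => v; rewrite !inE !Hi !inE /= => vuz; have [emv mF mK] := mP v; split=> //.
  apply: contra vuz => /orP[] /eqP mv; rewrite -[v]mK mv ?mu ?mz eqxx ?orbT //.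
rewrite /avoid edge_copy emv /=; apply: contra vuz => vF.
have /mF vA : [set v; m v] \in Fi i by rewrite inE imset_copy2 mem_edges.
by have := set21 v (m v); rewrite vA !inE.
Qed.

End Copies.

(** * DCell graphs *)

Lemma card_dcell n k :
  #|dcell_vertex n k.+1| = #|dcell_vertex n k|.+1 * #|dcell_vertex n k|.
Proof. by rewrite card_prod card_ord. Qed.

Lemma card_dcell0 n : #|dcell_vertex n 0| = n.
Proof. exact: card_ord. Qed.

Lemma leq_card_dcell n k : 0 < n -> n <= #|dcell_vertex n k|.
Proof.
move=> n0; elim: k => [|k IHk]; first by rewrite card_dcell0.
by rewrite card_dcell mulSn (leq_trans IHk) ?leq_addr.
Qed.

Lemma uid_lt n k (v : dcell_vertex n k) : uid v < #|dcell_vertex n k|.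
Proof.
elim: k v => [v|k IHk [j v]]; first by rewrite card_dcell0 (ltn_ord v).
rewrite card_dcell /= mulSn -addSn; apply: leq_add; first exact: IHk.
by rewrite leq_mul2r -ltnS ltn_ord orbT.
Qed.

Lemma uid_inj n k : injective (@uid n k).
Proof.
elim: k => [|k IHk]; first exact: val_inj.
case=> [j v] [l w] /= E; have := uid_lt v; have := uid_lt w.
move: E IHk; set t := #|_|; move=> E IHk wt vt; have t0 : 0 < t by apply: leq_trans wt.
(* The leading digit is the quotient by [t]. *)
have jl : (j : nat) = l.
  by have := congr1 (divn^~ t) E; rewrite ![_ + _ * _]addnC !divnMDl // !divn_small // !addn0.
by move: E; rewrite jl => /addIn/IHk->; congr (_, _); apply: val_inj.
Qed.

(** In copy [j] the uids run through the other copies in increasing order: uid [p] leads to copy [p]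
    if [p < j] and to [p.+1] otherwise, which is [bump j p]. *)
Lemma dcell_copies n k : 0 < n ->
  let C : finType := 'I_#|dcell_vertex n k|.+1 in
  exists (target : C -> dcell_vertex n k -> C) (port : C -> C -> dcell_vertex n k),
    [/\ forall j v, target j v != j,
        forall j l, l != j -> target j (port j l) = l,
        forall j v, port j (target j v) = v,
        forall x y : C * dcell_vertex n k, @dcell n k.+1 x y =
          (x.1 == y.1) && dcell x.2 y.2 || (y == partner target port x)
      & forall j v, target j v = bump j (uid v) :> nat].
Proof.
move=> n0 C; set V := dcell_vertex n k in C *.
pose rank v : 'I_#|V| := Ordinal (uid_lt v).
have rank_inj : injective rank by move=> v w [/uid_inj].
have [vtx vtxK rankK] : bijective rank by apply: inj_card_bij; rewrite ?card_ord.
pose target (j : C) v : C := lift j (rank v).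
(* The default, the vertex of rank 0, is reached only for [l = j]. *)
pose port (j l : C) := oapp vtx (vtx (Ordinal (leq_trans n0 (leq_card_dcell k n0)))) (unlift j l).
have portK j l : l != j -> target j (port j l) = l.
  by rewrite eq_sym => /unlift_some[r lr rE]; rewrite /target /port rE /= rankK.
have targetK j v : port j (target j v) = v by rewrite /port liftK /= vtxK.
exists target, port; split=> // [j v|[j v] [l w]]; first by rewrite eq_sym neq_lift.
rewrite /= -orbA; congr (_ || _); rewrite xpair_eqE /dcell_link /=.
(* Two vertices are partners exactly when each one targets the copy of the other; what remains is
   arithmetic on uids and copy numbers. *)
have -> : (l == target j v) && (w == port (target j v) j) =
          (l == target j v) && (target l w == j).
  apply: andb_id2l => /eqP lE; rewrite -lE; apply/eqP/eqP => [->|<-].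
    by rewrite portK // lE neq_lift.
  by rewrite targetK.
have valE (x y : C) : (x == y) = (x == y :> nat) by [].
rewrite !valE /= /bump; move: (uid v) (uid w) (val j) (val l) => p q a b.
by case: (leqP a p); case: (leqP b q); lia.
Qed.

Lemma degree_dcell n k (v : dcell_vertex n k) : 0 < n -> degree (@dcell n k) v = n + k - 1.
Proof.
move=> n0; elim: k v => [v|k IHk [j v]].
  rewrite addn0 subn1 -[in RHS](card_ord n) (cardD1 v) inE /= /degree.
  by apply: eq_card => w; rewrite !inE eq_sym andbT.
have [target [port [tN pK tK EE _]]] := dcell_copies k n0.
by rewrite (degree_step tN EE) IHk; lia.
Qed.

(** The induction starts at [k = 1], since [K_n] has no perfect matching for odd [n]. For even [n]
    the copies are factorable; for odd [n] the [n.+1] copies are, as vertices of a complete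
    graph. *)
Lemma factorable_dcell n k : 0 < n -> 0 < k -> factorable (@dcell n k) (n + k - 1).
Proof.
move=> n0; elim: k => // -[|k] IHk _; last first.
  have [target [port [tN pK tK EE _]]] := dcell_copies k.+1 n0.
  have -> : n + k.+2 - 1 = (n + k.+1 - 1).+1 by lia.
  exact: (factorable_step tN pK tK EE (IHk _)).
rewrite addnK; have [target [port [tN pK tK EE _]]] := dcell_copies 0 n0.
have [oddn|evenn] := boolP (odd n).
  have [nu [nuK nuE nu_inj]] := near_factorization oddn.
  apply: (factorable_odd tN pK tK EE nuK nuE nu_inj) => //.
  by apply: complete_factorable; rewrite // card_ord card_dcell0.
case: n n0 evenn target port tN pK tK EE {IHk} => // n _ /=; rewrite negbK => oddn.
move=> target port tN pK tK EE.
apply: (factorable_step tN pK tK EE); apply: complete_factorable => //.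
exact: card_ord.
Qed.

Lemma matchable_dcell n k : 0 < n -> 0 < k -> matchable (@dcell n k) [set: _].
Proof.
move=> n0 k0; apply: matchable_mono (factorable_avoid (F := set0) (factorable_dcell n0 k0) _).
  by move=> v w /andP[].
by rewrite cards0; lia.
Qed.

Lemma bicritical_dcellS n k : 2 < #|dcell_vertex n k| ->
  0 < n -> 0 < k -> bicritical (@dcell n k) -> bicritical (@dcell n k.+1).
Proof.
move=> t3 n0 k0 bi; have [target [port [tN pK tK EE _]]] := dcell_copies k n0.
by apply: (bicritical_step tN pK tK EE) => //; [rewrite card_ord | apply: matchable_dcell].
Qed.

(** The bound on [n] excludes the hexagon, where removing two vertices at distance two isolates a
    vertex. *)
Lemma bicritical_dcell n k : 2 < n -> 0 < k -> bicritical (@dcell n k).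
Proof.
move=> n3; have n0 : 0 < n by lia.
elim: k => // -[|k] IHk _; last first.
  by apply: bicritical_dcellS (IHk _) => //; apply: leq_trans n3 (leq_card_dcell _ n0).
have [target [port [tN pK tK EE _]]] := dcell_copies 0 n0.
have [oddn|evenn] := boolP (odd n).
  by apply: (bicritical_odd tN pK tK EE); rewrite ?card_dcell0 // card_ord card_dcell0.
have evenV : ~~ odd #|'I_n| by rewrite card_ord.
apply: (bicritical_step tN pK tK EE); rewrite ?card_dcell0 ?card_ord //.
  by apply: complete_matchable; rewrite cardsT.
exact: complete_bicritical.
Qed.

(** * The hexagon D_(1,2) *)

Definition ends (s : seq (nat * nat)) := flatten [seq [:: p.1; p.2] | p <- s].

Lemma avoid_sym (T : finType) (e : rel T) F : symmetric e -> symmetric (avoid e F).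
Proof. by move=> e_sym v w; rewrite /avoid e_sym setUC. Qed.

Lemma pairs_matchable (T : finType) (code : T -> nat) (r : rel T) s :
  injective code -> symmetric r -> uniq (ends s) ->
  (forall p, p \in s -> exists v w, [/\ code v = p.1, code w = p.2 & r v w]) ->
  matchable r [set v | code v \in ends s].
Proof.
move=> code_inj r_sym; elim: s => [|p s IHs].
  move=> _ _; rewrite (_ : [set v | _] = set0); first exact: matchable0.
  by apply/setP=> v; rewrite !inE.
rewrite /= inE negb_or -andbA => /and4P[p12 p1s p2s us] sP.
have [v [w [vp wp rvw]]] := sP p (mem_head _ _).
rewrite (_ : [set v | _] = v |: (w |: [set v | code v \in ends s])); last first.
  by apply/setP=> x; rewrite !inE -vp -wp !(inj_eq code_inj).
apply: matchableU2 => //; rewrite ?inE ?vp ?wp //.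
  by rewrite -(inj_eq code_inj) vp wp.
by apply: IHs => // q qs; apply: sP; rewrite inE qs orbT.
Qed.

(* The vertices of D_(1,2) are named by their uid; its edges form the hexagon
   0-1-4-5-3-2, split here into its two perfect matchings. *)
Definition hex_pairs1 := [:: (0, 1); (2, 3); (4, 5)].
Definition hex_pairs2 := [:: (0, 2); (1, 4); (3, 5)].
Definition hexagon := linked (hex_pairs1 ++ hex_pairs2).

(** The inverse of [uid], which is [a_0 + 2 a_1] here; meaningful for [i < 6]. *)
Definition hexv (i : nat) : dcell_vertex 2 1 :=
  (inord (i./2), inord (odd i) : 'I_2).

Lemma uid_hexv i : i < 6 -> uid (hexv i) = i.
Proof.
move=> i6.
have -> : uid (hexv i) = (inord (odd i) : 'I_2) + (inord i./2 : 'I_#|'I_2|.+1) * #|'I_2|.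
  by [].
rewrite !inordK ?card_ord ?muln2 ?odd_double_half //;
  by move: i i6; do 6![case=> //].
Qed.

Lemma card_hex : #|dcell_vertex 2 1| = 6.
Proof. by rewrite card_dcell card_dcell0. Qed.

Lemma uid_hex (v : dcell_vertex 2 1) : uid v < 6.
Proof. by rewrite -card_hex uid_lt. Qed.

Lemma dcell21E (x y : dcell_vertex 2 1) : dcell x y = hexagon (uid x) (uid y).
Proof.
case: x y => [[j j3] [v v2]] [[l l3] [w w2]].
have : j < 3 by rewrite -[3]/(2.+1) -{1}(card_ord 2).
have : l < 3 by rewrite -[3]/(2.+1) -{1}(card_ord 2).
rewrite /= /dcell_link /= -!(inj_eq val_inj) /= card_ord.
clear j3 l3; case: l => [|[|[|//]]] _; case: j => [|[|[|//]]] _;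
by case: v v2 => [|[|//]] _; case: w w2 => [|[|//]] _.
Qed.

(** Exhaustive search for a partner of the first remaining vertex; the fuel [n] bounds the number of
    pairs, at most three in a hexagon. *)
Fixpoint hex_matching (n : nat) (s : seq nat) : bool :=
  match n, s with
  | n'.+1, x :: s' => has (fun y => hexagon x y && hex_matching n' (rem y s')) s'
  | _, _ => nilp s
  end.

Lemma hex_matching_pairs n s : hex_matching n s ->
  exists2 t, perm_eq (ends t) s & all (fun p => hexagon p.1 p.2) t.
Proof.
elim: n s => [|n IHn] [|x s] //=; try by exists [::].
case/hasP=> y ys /andP[xy /IHn[t tE tP]]; exists ((x, y) :: t); rewrite /= ?xy //.
rewrite perm_cons perm_sym; apply: perm_trans (perm_to_rem ys) _.
by rewrite perm_cons perm_sym.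
Qed.

(* The vertices of copy j of D_(1,2) which are neither in U nor on a link of es;
   bump j x is the copy linked to the vertex of uid x in copy j. *)
Definition free_uids (es : seq (nat * nat)) (U : seq (nat * nat)) (j : nat) :=
  [seq x <- iota 0 6 | ((j, x) \notin U) && ~~ linked es j (bump j x)].

Lemma hex_matchable es U j : hex_matching 3 (free_uids es U j) ->
  matchable (@dcell 2 1)
    [set v | ((j, uid v) \notin U) && ~~ linked es j (bump j (uid v))].
Proof.
case/hex_matching_pairs=> t tE /allP tP.
rewrite (_ : [set v | _] = [set v | uid v \in ends t]); last first.
  by apply/setP=> v; rewrite !inE (perm_mem tE) mem_filter mem_iota add0n uid_hex leq0n !andbT.
have t6 x : x \in ends t -> x < 6.
  by rewrite (perm_mem tE) mem_filter mem_iota => /andP[].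
apply: (@pairs_matchable _ (@uid 2 1) _ t); [exact: uid_inj | exact: dcell_sym | |].
  by rewrite (perm_uniq tE) filter_uniq ?iota_uniq.
move=> p pt; have [p1 p2] : p.1 < 6 /\ p.2 < 6.
  split; apply: t6; apply/flattenP; exists [:: p.1; p.2];
    by rewrite ?(map_f (fun p => [:: p.1; p.2])) ?inE ?eqxx ?orbT.
by exists (hexv p.1), (hexv p.2); rewrite dcell21E !uid_hexv //; split=> //; apply: tP.
Qed.

(** Walks from [a] to [b] among the seven copies of [D_(1,2)] in [D_(2,2)], with exactly [n]
    intermediate copies, distinct and outside [used]. *)
Fixpoint walks (n a b : nat) (used : seq nat) : seq (seq (nat * nat)) :=
  if n is n'.+1 then
    flatten [seq [seq (a, c) :: w | w <- walks n' c b (c :: used)]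
            | c <- iota 0 7 & c \notin used]
  else [:: [:: (a, b)]].

Definition walks_upto (n a b : nat) (used : seq nat) : seq (seq (nat * nat)) :=
  flatten [seq walks m a b used | m <- iota 0 n].

(* D_(2,2) minus the vertices (a, p) and (b, q) is matched with the links of a
   walk through the copies from a to b. *)
Definition critical_ok (a p b q : nat) (es : seq (nat * nat)) : bool :=
  [&& ~~ linked es a (bump a p), ~~ linked es b (bump b q)
    & all (fun j => hex_matching 3 (free_uids es [:: (a, p); (b, q)] j)) (iota 0 7)].

(** At most four intermediate copies are tried. For [a = b] the walk consisting of [(a, a)] alone
    selects no link, because [bump a x] is never [a]. *)
Definition critical_check : bool :=
  all (fun a => all (fun p => all (fun b => all (fun q =>
    ((a, p) == (b, q)) || has (critical_ok a p b q) (walks_upto 5 a b [:: a; b]))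
    (iota 0 6)) (iota 0 7)) (iota 0 6)) (iota 0 7).

Definition detour_ok (i u z g h : nat) (es : seq (nat * nat)) : bool :=
  [&& ~~ linked es g h,
      all (fun x => linked es i (bump i x) == (x \in [:: u; z])) (iota 0 6)
    & all (fun j => (j == i) || hex_matching 3 (free_uids es [::] j)) (iota 0 7)].

(** The links at the two ends of the edge [p] lead to copies [b] and [c], which are then joined by a
    walk off copy [i] with at most three intermediate copies. *)
Definition detour_exists (i g h : nat) (p : nat * nat) : bool :=
  let b := bump i p.1 in let c := bump i p.2 in
  has (fun w => detour_ok i p.1 p.2 g h ((i, b) :: (i, c) :: w))
      (walks_upto 4 b c [:: i; b; c]).

(* For some edges p of the hexagon and links gh there is no detour.  But a set of
   two edges precludes the hexagon only if it meets both of its perfect matchings,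
   and then one of its two edges has a detour. *)
Definition detour_check : bool :=
  all (fun i => all (fun g => all (fun h => (g == h) ||
    all (fun p => all (fun q =>
      [|| has (fun x => [&& x \in [:: p.1; p.2], x \in [:: q.1; q.2]
                          & linked [:: (g, h)] i (bump i x)]) (iota 0 6),
          detour_exists i g h p | detour_exists i g h q])
      hex_pairs2) hex_pairs1) (iota 0 7)) (iota 0 7)) (iota 0 7).

Lemma critical_checkT : critical_check.
Proof. by lazy. Qed.

Lemma detour_checkT : detour_check.
Proof. by lazy. Qed.

Lemma ltn_copy (j : 'I_#|dcell_vertex 2 1|.+1) : j < 7.
Proof. by rewrite -[7]/(6.+1) -{1}card_hex. Qed.

(** The hexagon is not bicritical, so the general step does not apply; the links come from the
    computed walk. *)
Lemma bicritical_dcell22 : bicritical (@dcell 2 2).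
Proof.
have [target [port [tN pK tK EE targetE]]] := dcell_copies 1 (ltn0Sn 1).
suff critical (a b : 'I_#|dcell_vertex 2 1|.+1) (p q : dcell_vertex 2 1) :
    (a, p) != (b, q) -> matchable (@dcell 2 2) (~: [set (a, p); (b, q)]).
  by move=> [a p] [b q]; apply: critical.
move=> neq_uw.
have codeE j l (v w : dcell_vertex 2 1) :
    ((j : 'I_#|dcell_vertex 2 1|.+1, v) == (l, w)) = (((j : nat), uid v) == ((l : nat), uid w)).
  by rewrite !xpair_eqE (inj_eq (@uid_inj 2 1)).
have : has (critical_ok a (uid p) b (uid q)) (walks_upto 5 a b [:: val a; val b]).
  have inCopy (j : 'I_#|dcell_vertex 2 1|.+1) : (j : nat) \in iota 0 7.
    by rewrite mem_iota ltn_copy.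
  have inHex (v : dcell_vertex 2 1) : uid v \in iota 0 6 by rewrite mem_iota uid_hex.
  move/allP/(_ _ (inCopy a))/allP/(_ _ (inHex p)): critical_checkT.
  move/allP/(_ _ (inCopy b))/allP/(_ _ (inHex q)).
  by rewrite -codeE (negPf neq_uw).
case/hasP=> es _ /and3P[esu esw /allP es_ok].
apply: (glue_step tN pK tK EE (H := fun j l => linked es j l)) => [j l|j v|j].
- exact: linked_sym.
- rewrite targetE !inE !codeE => es_jv.
  by apply/norP; split; apply: contraTN es_jv; rewrite xpair_eqE => /andP[/eqP-> /eqP->].
have /hex_matchable : hex_matching 3 (free_uids es [:: (val a, uid p); (val b, uid q)] j).
  by apply: es_ok; rewrite mem_iota ltn_copy.
congr (matchable _ _); apply/setP=> v; by rewrite !inE !codeE targetE.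
Qed.

(** Each list is a perfect matching of the hexagon, which would survive if [F] missed it. *)
Lemma hex_pair_hit (F : {set {set dcell_vertex 2 1}}) (s : seq (nat * nat)) :
  s \in [:: hex_pairs1; hex_pairs2] ->
  ~ matchable (avoid (@dcell 2 1) F) [set: _] ->
  exists2 p, p \in s & [set hexv p.1; hexv p.2] \in F.
Proof.
move=> s12 bad.
have [/hasP[p ps pF]|/hasPn noF] :=
    boolP (has (fun p => [set hexv p.1; hexv p.2] \in F) s); first by exists p.
have [us s_all sP] : [/\ uniq (ends s), forall v : dcell_vertex 2 1, uid v \in ends s
    & all (fun p => [&& p.1 < 6, p.2 < 6 & hexagon p.1 p.2]) s].
  move: s12; rewrite !inE => /orP[]/eqP->; split=> // v; have := uid_hex v;
  by move: (uid v); do 6![case=> //].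
case: bad; rewrite (_ : [set: _] = [set v | uid v \in ends s]); last first.
  by apply/setP=> v; rewrite !inE s_all.
apply: (@pairs_matchable _ (@uid 2 1) _ s); rewrite //.
- exact: uid_inj.
- exact/avoid_sym/dcell_sym.
move=> p ps; have /and3P[p1 p2 hp] := allP sP p ps.
by exists (hexv p.1), (hexv p.2); rewrite /avoid dcell21E !uid_hexv // hp noF.
Qed.

Lemma detourable_dcell21
    (target : 'I_#|dcell_vertex 2 1|.+1 -> dcell_vertex 2 1 -> 'I_#|dcell_vertex 2 1|.+1) :
  (forall j v, target j v = bump j (uid v) :> nat) ->
  detourable target (@dcell 2 1) 2.
Proof.
move=> targetE i g h F Fe cF bad gh nontriv.
have inCopy (j : 'I_#|dcell_vertex 2 1|.+1) : (j : nat) \in iota 0 7.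
  by rewrite mem_iota ltn_copy.
have [p p1 pF] := hex_pair_hit (mem_head _ _) bad.
have [q q2 qF] := hex_pair_hit (mem_last _ _) bad.
have [p16 p26 pq] : [/\ p.1 < 6, p.2 < 6 & p.1 != p.2].
  by move: p1; rewrite !inE => /or3P[]/eqP->.
have [q16 q26 qq] : [/\ q.1 < 6, q.2 < 6 & q.1 != q.2].
  by move: q2; rewrite !inE => /or3P[]/eqP->.
have detourP r : r.1 < 6 -> r.2 < 6 -> r.1 != r.2 -> [set hexv r.1; hexv r.2] \in F ->
    detour_exists i g h r ->
  exists u z, [/\ [set u; z] \in F, u != z & detour target (@dcell 2 1) i u z g h].
  move=> r1 r2 r12 rF /hasP[w _ /and3P[gh_w /allP iw /allP copies]].
  set es := [:: _, _ & w] in gh_w iw copies.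
  exists (hexv r.1), (hexv r.2); split=> //.
    by rewrite -(inj_eq (@uid_inj 2 1)) !uid_hexv.
  exists (fun j l : 'I_#|dcell_vertex 2 1|.+1 => linked es (j : nat) (l : nat)); split=> //.
  - by move=> j l; apply: linked_sym.
  - move=> v; rewrite targetE (eqP (iw (uid v) _)) ?mem_iota ?uid_hex //.
    by rewrite !inE -!(inj_eq (@uid_inj 2 1)) !uid_hexv.
  move=> j ji; have := copies j (inCopy j); rewrite (inj_eq val_inj) (negPf ji).
  move/hex_matchable; congr (matchable _ _).
  by apply/setP=> v; rewrite !inE targetE.
move/allP/(_ _ (inCopy i))/allP/(_ _ (inCopy g))/allP/(_ _ (inCopy h)): detour_checkT.
rewrite (inj_eq val_inj) (negPf gh) => /allP/(_ _ p1)/allP/(_ _ q2).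
case/or3P=> [/hasP[x]|/detourP|/detourP]; [|exact|exact].
rewrite mem_iota => x6 /and3P[xp xq ghx].
have {}ghx : linked [:: (g, h)] i (target i (hexv x)).
  by move: ghx; rewrite /linked !inE !xpair_eqE -!(inj_eq val_inj) /= targetE uid_hexv.
(* The hexagon is 2-regular, so the edges [p] and [q], which share the end [x] of the link, form the
   whole star of [x]. *)
case/negP: (nontriv _ ghx).
set A := [set hexv p.1; hexv p.2] in pF; set B := [set hexv q.1; hexv q.2] in qF.
have AB : A != B.
  have inB j : j < 6 -> hexv j \in B -> j \in [:: q.1; q.2].
    by move=> j6; rewrite !inE -!(inj_eq (@uid_inj 2 1)) !uid_hexv.
  have disjoint_pairs : all (fun p => all (fun q =>
      ~~ ((p.1 \in [:: q.1; q.2]) && (p.2 \in [:: q.1; q.2]))) hex_pairs2) hex_pairs1.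
    by [].
  have := allP (allP disjoint_pairs _ p1) _ q2; apply: contraNneq => AB.
  by rewrite !inB // -AB ?set21 ?set22.
have xin r : x \in [:: r.1; r.2] -> [set hexv r.1; hexv r.2] \in F ->
    [set hexv r.1; hexv r.2] \in incident_edges (@dcell 2 1) (hexv x).
  move=> xr /(subsetP Fe) rE; rewrite inE rE; move: xr.
  by rewrite !inE => /orP[]/eqP->; rewrite eqxx ?orbT.
have /eqP <- : [set A; B] == incident_edges (@dcell 2 1) (hexv x).
  rewrite eqEcard subUset !sub1set !xin // card_incident_edges ?degree_dcell //.
    by rewrite cards2 AB.
  exact: dcell_sym.
by rewrite subUset !sub1set pF qF.
Qed.

(** * Super-matchedness *)

Lemma bigmin_leq (I : finType) (P : pred I) (f : I -> nat) x i :
  P i -> \big[minn/x]_(j | P j) f j <= f i.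
Proof.
move=> Pi; have := mem_index_enum i; elim: (index_enum I) => //= j s IHs.
rewrite inE big_cons => /predU1P[<-|/IHs le_s]; first by rewrite Pi geq_minl.
by case: ifP => // _; rewrite geq_min le_s orbT.
Qed.

Lemma leq_bigmin (I : finType) (P : pred I) (f : I -> nat) x d :
  d <= x -> (forall i, P i -> d <= f i) -> d <= \big[minn/x]_(j | P j) f j.
Proof.
by move=> dx df; elim/big_ind: _ => // m p dm dp; rewrite leq_min dm.
Qed.

Lemma incident_preclusion (T : finType) (e : rel T) v :
  matching_preclusion e (incident_edges e v).
Proof.
apply/andP; split; first by apply/subsetP=> A; rewrite inE => /andP[].
apply/existsPn => M; apply/negP => /and3P[/subsetP Me _ /eqP covM].
have /bigcupP[A /Me + vA] : v \in cover M by rewrite covM inE.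
by rewrite !inE vA andbT => /andP[/negPf->].
Qed.

Lemma preclusion_unmatchable (T : finType) (e : rel T) F :
  matching_preclusion e F -> ~ matchable (avoid e F) [set: T].
Proof.
case/andP=> _ /existsPn noM [m mP]; case/negP: (noM [set [set v; m v] | v : T]).
have {}mP v : [/\ e v (m v), [set v; m v] \notin F & m (m v) = v].
  by have [//|_ /andP[]] := mP v.
apply/and3P; split.
- apply/subsetP=> _ /imsetP[v _ ->]; have [emv mF _] := mP v.
  by rewrite inE mF mem_edges.
- apply/trivIsetP=> _ _ /imsetP[v _ ->] /imsetP[w _ ->]; apply: contraR.
  case/pred0Pn=> x /andP[/=]; have [_ _ mK] := mP w.
  have [_ _ mKv] := mP v.
  case/set2P=> -> /set2P[] vw; rewrite ?vw //.
  - by rewrite mK setUC.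
  - by rewrite -vw mKv setUC.
  by rewrite -(mKv) vw mK.
apply/eqP/setP=> v; rewrite [in RHS]inE; apply/bigcupP.
by exists [set v; m v]; [apply: imset_f | apply: set21].
Qed.

(** A preclusion set of at most [d] edges contains a star by [super], and equals it since stars have
    [d] edges; stars are themselves preclusion sets. *)
Lemma super_super_matched (T : finType) (e : rel T) d (x0 : T) :
  symmetric e -> (forall v, degree e v = d) -> super e d ->
  mp e = d /\ super_matched e.
Proof.
move=> e_sym e_deg e_super.
have cinc v : #|incident_edges e v| = d by rewrite card_incident_edges.
have inc v : incident_edges e v \subset edges e by case/andP: (incident_preclusion e v).
have small F : matching_preclusion e F -> #|F| <= d -> exists v, F = incident_edges e v.
  move=> Fpre leF; have /andP[Fe _] := Fpre.
  have [v vF] := e_super F Fe leF (preclusion_unmatchable Fpre).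
  by exists v; apply/eqP; rewrite eq_sym eqEcard vF cinc.
have mpE : mp e = d.
  apply/eqP; rewrite eqn_leq /mp; apply/andP; split.
    by rewrite -(cinc x0); apply: bigmin_leq; apply: incident_preclusion.
  (* The default value of the minimum, the number of all edges, is at least the size of a star. *)
  apply: leq_bigmin => [|F Fpre]; first by rewrite -(cinc x0) subset_leq_card.
  have [leF|/ltnW //] := leqP #|F| d.
  by have [v ->] := small F Fpre leF; rewrite cinc.
split=> //; split=> [|F /andP[Fpre /eqP cF]]; last by apply: small; rewrite ?cF ?mpE.
rewrite mpE /min_degree; apply/esym/eqP; rewrite eqn_leq; apply/andP; split.
  by rewrite -(e_deg x0); apply: bigmin_leq.
by apply: leq_bigmin => [|v _]; rewrite ?e_deg // -(e_deg x0) max_card.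
Qed.

Lemma super_dcell n k : 1 < n -> 1 < k -> super (@dcell n k) (n + k - 1).
Proof.
case: k => [|[|k]] // n2 _; have n0 := ltnW n2.
have [target [port [tN pK tK EE targetE]]] := dcell_copies k.+1 n0.
have -> : n + k.+2 - 1 = (n + k.+1 - 1).+1 by lia.
apply: (super_step tN pK tK EE); first by lia.
- exact: dcell_sym.
- exact: dcell_irr.
- exact: factorable_dcell.
- by move=> v; apply: degree_dcell.
have [/andP[/eqP n2' /eqP k0]|nk] := boolP ((n == 2) && (k == 0)).
  subst n k; exact: (detourable_dcell21 targetE).
apply: (bicritical_detourable tN pK tK); first by lia.
- exact: dcell_sym.
- exact: dcell_irr.
- by move=> v; apply: degree_dcell.
- rewrite card_ord card_dcell mulSn.
  by have := leq_card_dcell k n0; nia.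
- exact: matchable_dcell.
have [n3|n3] := ltnP 2 n; first exact: bicritical_dcell.
have {n3} n2' : n = 2 by lia.
(* For [n = 2] the copies are now at least [D_(2,2)], so the induction starts there instead of at
   the hexagon. *)
subst n; case: k nk {target port tN pK tK EE targetE} => // k _.
elim: k => [|k IHk]; first exact: bicritical_dcell22.
apply: bicritical_dcellS IHk => //; rewrite card_dcell mulSn.
by have := leq_card_dcell k.+1 n0; nia.
Qed.

Theorem theorem25 (k n : nat) (hk : 2 <= k) (hn : 2 <= n) :
  mp (@dcell n k) = n + k - 1 /\ super_matched (@dcell n k).
Proof.
have n0 := ltnW hn.
have /card_gt0P[v0 _] := leq_trans n0 (leq_card_dcell k n0).
apply: (super_super_matched v0) (super_dcell hn hk); first exact: dcell_sym.
by move=> v; apply: degree_dcell.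
Qed.
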